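(* For every $n\ge 1$ there is a word over $\mathbb{P}$ (equivalently, a permutation) of length $\lceil (n^2+1)/2\rceil$ that contains, for every permutation $\pi$ of length $n$, a subsequence order-isomorphic to $\pi$.
   Context: $\mathbb{P}$ is the set of positive integers. A permutation of length $n$ is a word containing each letter of $[n]$ exactly once. Words $u,v$ of length $k$ are order-isomorphic if $u(i)>u(j)\iff v(i)>v(j)$ for all $i,j\in[k]$. A word $w$ contains a subsequence order-isomorphic to $\pi$ if there are indices $i_1<\cdots<i_n$ with $w(i_1)\cdots w(i_n)$ order-isomorphic to $\pi$. *)

(* Defs.v *)
From mathcomp Require Import all_boot.
Set Implicit Arguments. Unset Strict Implicit. Unset Printing Implicit Defensive.

Definition is_perm (n : nat) (p : seq nat) : Prop := perm_eq p (iota 1 n).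

Definition order_iso (u v : seq nat) : Prop :=
  size u = size v /\
  forall i j, i < size u -> j < size u ->
    (nth 0 u i > nth 0 u j) = (nth 0 v i > nth 0 v j).

Definition contains_pattern (w pi : seq nat) : Prop :=
  exists u, subseq u w /\ order_iso u pi.

Definition word_over_P (w : seq nat) : Prop := all (fun x => 0 < x) w.

(* ceil((n^2+1)/2) = floor((n^2+2)/2) *)
Definition ceil_half_sq_plus1 (n : nat) : nat := (n ^ 2 + 2) %/ 2.

(* Main.v *)
Require Import Defs.
From mathcomp Require Import all_boot zify.

(* The word is the zigzag word with n runs over [1..n], alternately the odd
   letters increasing and the even letters decreasing, plus a final 1 if n is
   even; equal letters are then made distinct so that they read as descents.
   If k+1 occurs before k in the permutation, both may therefore be sent to
   the same letter, which frees one letter.  When they are moreover not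
   adjacent, the collapsed permutation and its shift by 1 together use 2n+1
   runs, so one of them uses at most n.  If k+1 before k always implies
   adjacency, every step of the permutation is an ascent or a descent by 1, and
   the number of runs telescopes to n+1 - [n odd] - [last letter even].  In the
   remaining case of even n and odd last letter, one uses the extra 1 or a
   suitable tie. *)

(** * Words read with ties as descents, and their standardization *)

(* Ties in [u] count as descents. *)
Definition weak_iso (u p : seq nat) : Prop :=
  size u = size p /\
  forall i j, i < j < size p -> (nth 0 u i < nth 0 u j) = (nth 0 p i < nth 0 p j).

(* Of two equal letters, the earlier one becomes the larger. *)
Fixpoint standardize (N : nat) (w : seq nat) : seq nat :=
  if w is x :: w' then x * N.+1 + size w' :: standardize N w' else [::].

Lemma size_standardize N (w : seq nat) : size (standardize N w) = size w.
Proof. by elim: w => //= x w ->. Qed.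

Lemma standardize_gt0 N (w : seq nat) : all (leq 1) w -> all (leq 1) (standardize N w).
Proof. by elim: w => //= x w IH /andP[x0 /IH->]; rewrite andbT; nia. Qed.

(** The offset added to a letter counts the letters after it: it breaks ties downwards and, being
    below [N.+1], never bridges the gap between distinct letters. The bounds on [v] carry this
    through the induction. *)
Lemma subseq_standardize N (u w : seq nat) : size w <= N -> subseq u w ->
  exists v : seq nat, [/\ subseq v (standardize N w), size v = size u,
    forall i, i < size u ->
      nth 0 u i * N.+1 <= nth 0 v i < nth 0 u i * N.+1 + size w &
    forall i j, i < j < size u ->
      (nth 0 v i < nth 0 v j) = (nth 0 u i < nth 0 u j) /\
      (nth 0 v j < nth 0 v i) = (nth 0 u j <= nth 0 u i)].
Proof.
elim: w u => [|x w IH] u /=.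
  by move=> _ /eqP->; exists [::]; split=> // i j; rewrite andbC.
move=> sN; case: u => [|y u]; first by exists [::]; split=> // i j; rewrite andbC.
case: eqP => [->|_] sub.
  have [|v [sv eqs bnd ord]] := IH u _ sub; first by lia.
  exists (x * N.+1 + size w :: v); split=> /=; first by rewrite eqxx.
  - by rewrite eqs.
  - by case=> [|i] /= lti; [lia | have /andP[] := bnd i lti; move=> -> /=; lia].
  - case=> [|i] [|j] //= ltij; last exact: ord.
    by have := bnd j ltij; nia.
have [|v [sv eqs bnd ord]] := IH (y :: u) _ sub; first by lia.
exists v; split=> //; first exact: subseq_trans sv (subseq_cons _ _).
by move=> i lti; have /andP[] := bnd i lti; move=> -> /=; lia.
Qed.

Lemma nth_uniq_neq (p : seq nat) i j : uniq p -> i < j < size p ->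
  nth 0 p i != nth 0 p j.
Proof.
by move=> up /andP[ij sj]; rewrite nth_uniq ?(ltn_trans ij) // neq_ltn ij.
Qed.

Lemma contains_standardize (u w p : seq nat) : uniq p -> weak_iso u p -> subseq u w ->
  contains_pattern (standardize (size w) w) p.
Proof.
move=> up [eqs iso] /(subseq_standardize _ _ _ (leqnn _))[v [sv eqsv _ ord]].
exists v; split=> //; split; first by rewrite eqsv.
have neq i j := nth_uniq_neq p i j up.
rewrite eqsv eqs => i j si sj; have [ij|ji|->] := ltngtP i j.
- have hij : i < j < size p by lia.
  by have := neq _ _ hij; have := iso _ _ hij; rewrite -eqs in hij; have := ord _ _ hij; lia.
- have hij : j < i < size p by lia.
  by have := iso _ _ hij; rewrite -eqs in hij; have := ord _ _ hij; lia.
- by rewrite !ltnn.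
Qed.

Lemma weak_iso_map (f : nat -> nat) (p : seq nat) : uniq p ->
  (forall x y : nat, x \in p -> y \in p -> x < y ->
     f x < f y \/ f x = f y /\ index y p < index x p) ->
  weak_iso (map f p) p.
Proof.
move=> up fP; split=> [|i j /andP[ij sj]]; first by rewrite size_map.
have si := ltn_trans ij sj.
rewrite !(nth_map 0) //.
have ne : nth 0 p i != nth 0 p j by apply: nth_uniq_neq; rewrite ?ij.
have ip : nth 0 p i \in p := mem_nth 0 si.
have jp : nth 0 p j \in p := mem_nth 0 sj.
have [lt|gt|eq] := ltngtP (nth 0 p i) (nth 0 p j).
- by have := fP _ _ ip jp lt; rewrite !index_uniq //; lia.
- by have := fP _ _ jp ip gt; lia.
- by rewrite eq eqxx in ne.
Qed.

(** * The zigzag word and greedy embedding into it *)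

(* Letters lie in runs of their own parity, odd runs increasing and even runs
   decreasing; [step a b] is the number of runs to advance from an occurrence
   of [a] to reach the next occurrence of [b]. *)
Definition step (a b : nat) : nat :=
  if odd a != odd b then 1 else if (if odd a then a < b else b < a) then 0 else 2.

(* The initial letter 0 stands for a position just before the first (odd) run. *)
Fixpoint score (a : nat) (s : seq nat) : nat :=
  if s is b :: s' then step a b + score b s' else 0.

Definition rest_of_run (n : nat) (o : bool) (a : nat) : seq nat :=
  if o then [seq x <- iota a.+1 (n - a) | odd x]
  else rev [seq x <- iota 1 a.-1 | ~~ odd x].

(** The sentinels [0] and [n.+1] stand just before an increasing and a decreasing run. *)
Definition run (n : nat) (o : bool) : seq nat :=
  rest_of_run n o (if o then 0 else n.+1).

Fixpoint zigzag (n : nat) (o : bool) (m : nat) : seq nat :=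
  if m is m'.+1 then run n o ++ zigzag n (~~ o) m' else [::].

Lemma zigzagS n o m : zigzag n o m.+1 = run n o ++ zigzag n (~~ o) m.
Proof. by []. Qed.

Lemma subseq_rest_of_run n o a b : odd b = o -> 0 < b <= n ->
  (if o then a < b else b < a) -> subseq (b :: rest_of_run n o b) (rest_of_run n o a).
Proof.
rewrite /rest_of_run; case: o => ob /andP[b0 bn] ab.
  have -> : n - a = (b - a.+1) + (n - b).+1 by lia.
  rewrite iotaD filter_cat; have -> : a.+1 + (b - a.+1) = b by lia.
  by rewrite [iota b _]/= [filter _ (b :: _)]/= ob suffix_subseq.
have -> : a.-1 = b.-1 + (a - b.+1).+1 by lia.
rewrite iotaD filter_cat rev_cat; have -> : 1 + b.-1 = b by lia.
by rewrite [iota b _]/= [filter _ (b :: _)]/= ob /= rev_cons cat_rcons suffix_subseq.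
Qed.

Lemma subseq_run n b : 0 < b <= n ->
  subseq (b :: rest_of_run n (odd b) b) (run n (odd b)).
Proof. by move=> bn; apply: subseq_rest_of_run => //; case: odd; lia. Qed.

(** Greedy reading: what remains after an occurrence of [a] is the rest of its run and [m] whole
    runs, and a step uses up as many run boundaries as it costs. *)
Lemma subseq_zigzag_from n a (s : seq nat) m : all (fun x => 0 < x <= n) s -> score a s <= m ->
  subseq s (rest_of_run n (odd a) a ++ zigzag n (~~ odd a) m).
Proof.
elim: s a m => [|b s IH] a m /=; first by rewrite sub0seq.
move=> /andP[bn sn]; rewrite /step.
have tail m' : score b s <= m' ->
    subseq (b :: s) ((b :: rest_of_run n (odd b) b) ++ zigzag n (~~ odd b) m').
  by move=> sm /=; rewrite eqxx; apply: IH.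
case: eqP => [eab|/eqP nab] /=.
  case: ifP => ab; rewrite ?add0n => sm.
    apply: subseq_trans (tail m sm) _; rewrite -eab; apply: cat_subseq => //.
    exact: subseq_rest_of_run.
  (* Same parity, wrong direction: the next run has the other parity, so [b] is found one run
     later. *)
  case: m sm => [|[|m]] // sm; apply: subseq_trans (tail m _) _; first by lia.
  rewrite !zigzagS negbK eab catA; apply: subseq_trans (suffix_subseq _ _).
  by apply: cat_subseq => //; apply: subseq_run.
case: m => [|m] // sm; apply: subseq_trans (tail m _) _; first by lia.
rewrite zigzagS; apply: subseq_trans (suffix_subseq _ _).
have eb : ~~ odd a = odd b by case: (odd a) (odd b) nab => [] [].
by rewrite eb; apply: cat_subseq => //; apply: subseq_run.
Qed.

(** The start [a = 0] is even with no letter below it, so the rest of its run is empty. *)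
Lemma subseq_zigzag n (s : seq nat) : all (fun x => 0 < x <= n) s -> score 0 s <= n ->
  subseq s (zigzag n true n).
Proof. exact: subseq_zigzag_from. Qed.

Lemma count_odd_iota n : count odd (iota 1 n) = uphalf n.
Proof. by elim: n => // n IH; rewrite -[n.+1]addn1 iotaD count_cat IH /=; lia. Qed.

Lemma count_even_iota n : count (predC odd) (iota 1 n) = n./2.
Proof.
by have := count_predC odd (iota 1 n); rewrite count_odd_iota size_iota; lia.
Qed.

Lemma size_run n o : size (run n o) = if o then uphalf n else n./2.
Proof.
case: o; rewrite /run /rest_of_run ?size_rev size_filter.
  by rewrite subn0 count_odd_iota.
exact: count_even_iota.
Qed.

Lemma size_zigzag n o m : size (zigzag n o m) =
  if o then uphalf m * uphalf n + m./2 * n./2 else uphalf m * n./2 + m./2 * uphalf n.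
Proof.
elim: m o => [|m IH] o; first by case: o.
by rewrite /= size_cat size_run IH; case: o => /=; nia.
Qed.

Lemma zigzag_gt0 n o m : all (leq 1) (zigzag n o m).
Proof.
elim: m o => //= m IH o; rewrite all_cat IH andbT.
by apply/allP => x; case: o; rewrite /run /rest_of_run ?mem_rev mem_filter mem_iota; lia.
Qed.

(** * Score identities *)

Lemma score_cat a (s t : seq nat) : score a (s ++ t) = score a s + score (last a s) t.
Proof. by elim: s a => //= b s IH a; rewrite IH addnA. Qed.

(** Shifting by 1 flips parities and hence run directions: a step costs 1 both times, or 0 once and
    2 once. *)
Lemma score_shift_from a (s : seq nat) : path (fun x y => x != y) a s ->
  score a s + score a.+1 (map succn s) = 2 * size s.
Proof.
elim: s a => //= b s IH a /andP[ab /IH]; rewrite /step /= ltnS.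
by case: (odd a) (odd b) => [] [] /=; repeat (case: ifP => ?); lia.
Qed.

Lemma score_shift b (s : seq nat) : 0 < b -> path (fun x y => x != y) b s ->
  score 0 (b :: s) + score 0 (map succn (b :: s)) = 2 * size s + 3.
(* From the initial [0], an odd first letter costs 1 and an even one 2, whence the 3. *)
Proof. by move=> b0 /score_shift_from /=; rewrite /step /=; case: (odd b) => /=; lia. Qed.

(** A repeated letter costs 2, which fits the telescoping formula for even letters only. *)
Definition mild (x y : nat) : bool :=
  [|| x < y, x == y.+1 | (x == y) && ~~ odd x].

(* Along a mild step, [step x y = 1 + [x even] - [y odd]], which telescopes. *)
Lemma score_mild a (s : seq nat) : path mild a s ->
  score a s + 2 * count odd s + ~~ odd (last a s) = 2 * size s + ~~ odd a.
Proof.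
elim: s a => [|b s IH] a /=; first by lia.
move=> /andP[ab /IH]; suff : step a b + odd b = 1 + ~~ odd a by lia.
move: ab; rewrite /mild /step.
case/or3P => [ab|/eqP->|/andP[/eqP-> /negbTE->]] /=; last by rewrite ltnn.
  by case: (odd a) (odd b) => [] [] /=; repeat (case: ifP => ?); lia.
by case: (odd b).
Qed.

(** * Merging letters *)

Lemma path_index (e : rel nat) (p : seq nat) : uniq p ->
  (forall y : nat, y \in p -> e 0 y) ->
  (forall x y : nat, x \in p -> y \in p -> index y p = (index x p).+1 -> e x y) ->
  path e 0 p.
Proof.
move=> up e0 eP; apply/(pathP 0) => -[|i] lti /=; first by apply: e0; apply: mem_nth.
by apply: eP; rewrite ?mem_nth ?index_uniq // (ltnW lti).
Qed.

Definition collapse (k x : nat) : nat := x - (k < x).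

Lemma weak_iso_collapse k (p : seq nat) : uniq p -> index k.+1 p < index k p ->
  weak_iso (map (collapse k) p) p.
Proof.
move=> up lt; apply: weak_iso_map => // x y _ _ xy.
have [ek|nk] := eqVneq x k; last by left; rewrite /collapse; lia.
have [ek'|nk'] := eqVneq y k.+1; last by left; rewrite /collapse; lia.
by right; rewrite ek ek' /collapse; split=> //; lia.
Qed.

Lemma count_collapse (P : pred nat) k n : k < n ->
  count P (map (collapse k) (iota 1 n)) = P k + count P (iota 1 n.-1).
Proof.
(* Split off [k.+1], whose image is the second copy of [k]. *)
move=> kn; have -> : n = k + (n - k.+1).+1 by lia.
rewrite iotaD map_cat addnS /= iotaD !count_cat /=.
have -> : map (collapse k) (iota 1 k) = iota 1 k.
  by apply: map_id_in => x; rewrite mem_iota /collapse; lia.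
have -> : map (collapse k) (iota (1 + k).+1 (n - k.+1)) = iota (1 + k) (n - k.+1).
  rewrite -add1n iotaDl -map_comp.
  by apply: map_id_in => x; rewrite mem_iota /collapse /=; lia.
have -> : collapse k (1 + k) = k by rewrite /collapse; lia.
by lia.
Qed.

Lemma mem_perm_iota n (p : seq nat) x : is_perm n p -> (x \in p) = (0 < x <= n).
Proof. by move/perm_mem->; rewrite mem_iota; lia. Qed.

(** Permutations with only such steps are the layered ones, the direct sums of decreasing
    permutations. *)
Definition layered (x y : nat) : bool := (x < y) || (x == y.+1).

(** Only [k] and [k.+1] get merged, so ascents and unit descents survive on letters that avoid one
    of the two. *)
Lemma mild_collapse_neq k x y : x != k -> y != k -> layered x y ->
  mild (collapse k x) (collapse k y).
Proof. by rewrite /layered /mild /collapse => xk yk /orP[lt|/eqP eq]; lia. Qed.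

Lemma mild_collapse_neqS k x y : x != k.+1 -> y != k.+1 -> layered x y ->
  mild (collapse k x) (collapse k y).
Proof. by rewrite /layered /mild /collapse => xk yk /orP[lt|/eqP eq]; lia. Qed.

(* For even [k] this keeps the balance of odd and even letters, while a last
   letter [k.+1] becomes even. *)
Definition push (k x : nat) : nat := x + ((x == k) || (x == k.+1)).

(** The only merger, of [k.+1] into [k.+2], gives an even tie; the only unit descent spoiled is from
    [k] to [k.-1]. *)
Lemma mild_push k x y : ~~ odd k -> layered x y ->
  ~~ ((x == k) && (y == k.-1)) -> mild (push k x) (push k y).
Proof.
rewrite /layered /mild /push => ek /orP[lt|/eqP->] nxy; last by lia.
have [xk|] := eqVneq x k.+1; last by lia.
by subst x; lia.
Qed.

(** * Embedding a single permutation, by cases *)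

Section Permutation.

Variables (n : nat) (p : seq nat).
Hypothesis p_perm : is_perm n p.

Let uniq_p : uniq p. Proof. by rewrite (perm_uniq p_perm) iota_uniq. Qed.
Let size_p : size p = n. Proof. by rewrite (perm_size p_perm) size_iota. Qed.
Let mem_p (x : nat) : (x \in p) = (0 < x <= n). Proof. exact: mem_perm_iota. Qed.

Let index_eq (x y : nat) : 0 < x <= n -> index x p = index y p -> x = y.
Proof.
rewrite -mem_p => xp; have := xp; rewrite -index_mem => lt eq.
by rewrite -(nth_index 0 xp) eq nth_index // -index_mem -eq.
Qed.

Lemma embed_distant k : 0 < k < n -> (index k.+1 p).+1 < index k p ->
  exists2 u, weak_iso u p & subseq u (zigzag n true n).
Proof.
move=> kn dist.
have iso : weak_iso (map (collapse k) p) p by apply: weak_iso_collapse => //; lia.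
have ne : path (fun x y => x != y) 0 (map (collapse k) p).
  rewrite -[0]/(collapse k 0) path_map; apply: path_index => // [y|x y].
    by rewrite mem_p /= /collapse; lia.
  rewrite !mem_p => xn yn eq /=; apply/eqP; rewrite /collapse => exy.
  have xy : x != y by apply: contra_eqN eq => /eqP->; lia.
  have [[ex ey]|[ex ey]] : x = k /\ y = k.+1 \/ x = k.+1 /\ y = k by lia.
    by move: eq; rewrite ex ey; lia.
  by move: eq; rewrite ex ey; lia.
(* Strictly below [n], so that the shifted word still fits. *)
have bnd : all (fun x => 0 < x < n) (map (collapse k) p).
  by apply/allP => _ /mapP[x xp ->]; move: xp; rewrite mem_p /collapse; lia.
have sz : size (map (collapse k) p) = n by rewrite size_map.
move: (map _ p) => u in iso ne bnd sz *.
have : score 0 u <= n \/ score 0 (map succn u) <= n.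
  case: u ne bnd sz {iso} => [|b s] /=; first by left.
  by move=> /andP[_ /score_shift H] /andP[/andP[/H]]; rewrite /=; lia.
case=> le.
  exists u => //; apply: subseq_zigzag le; apply: sub_all bnd => x; lia.
exists (map succn u); last first.
  by apply: subseq_zigzag le; rewrite all_map; apply: sub_all bnd => x /=; lia.
case: iso => eqs iso; split=> [|i j ij]; first by rewrite size_map.
by rewrite !(nth_map 0) ?ltnS ?iso //; lia.
Qed.

(** Suppose [x] directly precedes [y] with [y.+1 < x]. Each value stands at most one place before
    its predecessor, so by induction [y.+1], [y.+2], ... all come after [y]; this reaches [x], a
    contradiction. *)
Lemma path_layered :
  (forall k, 0 < k < n -> index k p <= (index k.+1 p).+1) -> path layered 0 p.
Proof.
move=> near; apply: path_index => // [y|x y]; first by rewrite mem_p /layered; lia.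
rewrite !mem_p => xn yn eq; apply/negPn/negP; rewrite /layered => nxy.
have ne : x != y by apply: contra_eqN eq => /eqP->; lia.
have yx : y.+1 < x by lia.
have far d : y.+1 + d <= n -> index y p < index (y.+1 + d) p.
  have neq z : y < z <= n -> index z p <> index y p.
    by move=> zn ez; have := @index_eq z y; lia.
  elim: d => [|d IH] dn.
    rewrite addn0; have := near y; have := neq y.+1.
    by have := @index_eq x y.+1; lia.
  by have := near (y.+1 + d); have := neq (y.+1 + d.+1); rewrite addnS; lia.
by have := far (x - y.+1); rewrite subnKC ?(ltnW yx) //; lia.
Qed.

Hypothesis layered_p : path layered 0 p.

Let score_p : score 0 p + 2 * uphalf n + ~~ odd (last 0 p) = 2 * n + 1.
Proof.
rewrite -size_p -(@score_mild 0).
  by rewrite (permP p_perm) count_odd_iota size_p.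
by apply: sub_path layered_p => x y; rewrite /layered /mild; lia.
Qed.

Lemma embed_layered_easy : odd n || ~~ odd (last 0 p) ->
  subseq p (zigzag n true n).
Proof.
move=> H; apply: subseq_zigzag; first by apply/allP => x; rewrite mem_p.
by move: score_p H; lia.
Qed.

Lemma embed_last1 : ~~ odd n -> last 0 p = 1 -> subseq p (zigzag n true n ++ [:: 1]).
Proof.
move=> en l1; have := score_p; rewrite l1 /= => sc.
have [q eq] : exists q, p = rcons q 1.
  by case/lastP: p l1 => [|q x] //; rewrite last_rcons => ->; exists q.
rewrite eq -cats1; apply: cat_subseq => //; apply: subseq_zigzag.
  by apply/allP => x xq; rewrite -mem_p eq mem_rcons inE xq orbT.
(* The whole permutation scores [n + 1], and a step to the final 1 costs at least 1. *)
move: sc; rewrite eq -cats1 score_cat /= /step.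
by case oq: (odd (last 0 q)) => /=; [case: ifP => ?|]; lia.
Qed.

Lemma embed_push k : ~~ odd n -> ~~ odd k -> 0 < k -> last 0 p = k.+1 ->
  index k.-1 p != (index k p).+1 ->
  exists2 u, weak_iso u p & subseq u (zigzag n true n).
Proof.
move=> en ek k0 lastp nadj; exists (map (push k) p).
  apply: weak_iso_map => // x y xp yp xy.
  (* Merging [k.+1] with [k.+2] is harmless because [k.+1] stands last. *)
  have [exk|] := eqVneq x k.+1; last by rewrite /push; lia.
  have [eyk|] := eqVneq y k.+2; last by rewrite /push; lia.
  right; rewrite exk eyk; split; first by rewrite /push; lia.
  have yl : index y p < size p by rewrite index_mem.
  have := index_eq y x; move: yp yl; rewrite mem_p exk eyk => yn yl.
  have : index k.+1 p = (size p).-1.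
    by rewrite -lastp -nth_last index_uniq // ltn_predL (leq_ltn_trans _ yl).
  by lia.
have kn : k.+1 < n.
  have : k.+1 \in p by rewrite -lastp; case: p lastp => //= *; apply: mem_last.
  by rewrite mem_p; lia.
apply: subseq_zigzag.
  by apply/allP => _ /mapP[x xp ->]; move: xp; rewrite mem_p /push; lia.
have mp : path mild 0 (map (push k) p).
  have : path (fun x y => layered x y && ~~ ((x == k) && (y == k.-1))) 0 p.
    apply: path_index => // [y|x y xp yp eq].
      by rewrite mem_p /layered; lia.
    have -> /= : layered x y.
      move/(pathP 0): layered_p => /(_ (index y p)).
      by rewrite index_mem eq /= nth_index // -eq nth_index // => ->.
    by apply: contraNN nadj => /andP[/eqP ex /eqP ey]; rewrite -ey -ex eq.
  move=> lay; have -> : 0 = push k 0 by rewrite /push; lia.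
  by apply: homo_path lay => x y /andP[]; apply: mild_push.
have := score_mild _ _ mp; rewrite size_map size_p.
have -> : last 0 (map (push k) p) = k.+2.
  have -> : 0 = push k 0 by rewrite /push; lia.
  by rewrite last_map lastp /push; lia.
have -> : count odd (map (push k) p) = uphalf n.
  rewrite (permP (perm_map _ p_perm)) -count_odd_iota.
  have -> : n = k.-1 + (2 + (n - k.+1)) by lia.
  rewrite !iotaD !map_cat !count_cat.
  congr (_ + (_ + _)).
  - by congr count; apply: map_id_in => x; rewrite mem_iota /push; lia.
  - have -> : 1 + k.-1 = k by lia.
    by rewrite /= /push !eqxx orbT eqn_leq ltnn andbF /=; lia.
  - by congr count; apply: map_id_in => x; rewrite mem_iota /push; lia.
by lia.
Qed.

(** The tie [k], [k] is an odd repeat, hence not mild: [score_mild] is applied on each side of it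
    and the tie costs 2. With one more odd letter and an even last letter, the total is exactly
    [n]. *)
Lemma embed_collapse k : ~~ odd n -> odd k -> last 0 p = k.+2 ->
  index k p = (index k.+1 p).+1 ->
  exists2 u, weak_iso u p & subseq u (zigzag n true n).
Proof.
move=> en ok lastp adj; exists (map (collapse k) p).
  by apply: weak_iso_collapse => //; lia.
have kn : k.+1 < n.
  have : k.+2 \in p by rewrite -lastp; case: p lastp => //= *; apply: mem_last.
  by rewrite mem_p; lia.
apply: subseq_zigzag.
  apply/allP => _ /mapP[x xp ->]; move: xp; rewrite mem_p /collapse; lia.
have kp : k \in p by rewrite mem_p; lia.
have k1p : k.+1 \in p by rewrite mem_p; lia.
have dropP x : x \in p -> drop (index x p) p = x :: drop (index x p).+1 p.
  by move=> xp; rewrite (drop_nth 0) ?index_mem // nth_index.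
(* Cutting between [k.+1] and [k] leaves a left part without [k] and a right part without [k.+1]. *)
have [s [t ep]] : exists s t, p = s ++ k.+1 :: k :: t.
  exists (take (index k.+1 p) p), (drop (index k p).+1 p).
  by rewrite -(dropP k kp) adj -(dropP k.+1 k1p) cat_take_drop.
have ec1 : collapse k k.+1 = k by rewrite /collapse; lia.
have ec : collapse k k = k by rewrite /collapse; lia.
have := uniq_p; have := layered_p; have := size_p; have := lastp.
have := count_collapse odd k n; rewrite -(permP (perm_map _ p_perm)) count_odd_iota.
rewrite ep last_cat size_cat /= map_cat count_cat /= ec ec1 ok.
rewrite cat_path cat_uniq /= !inE => cnt lastt szp.
move=> /andP[ps /and3P[sk1 _ pt]] /and5P[_].
rewrite !negb_or => /and3P[_ ks _] /andP[_ k1t] _ _.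
have ms : path mild 0 (map (collapse k) (rcons s k.+1)).
  rewrite -[0]/(collapse k 0).
  apply: (@homo_path_in _ _ [pred x | x != k] _ layered).
  - by move=> x y; apply: mild_collapse_neq.
  - rewrite /= all_rcons /= eq_sym -lt0n odd_gt0 // gtn_eqF //=.
    by apply/allP => x xs /=; apply: contraNneq ks => <-.
  - by rewrite rcons_path ps.
have mt : path mild k (map (collapse k) t).
  rewrite -{1}ec.
  apply: (@homo_path_in _ _ [pred x | x != k.+1] _ layered) => //.
  - by move=> x y; apply: mild_collapse_neqS.
  - rewrite /= ltn_eqF //=.
    by apply/allP => x xs /=; apply: contraNneq k1t => <-.
have := score_mild _ _ ms; have := score_mild _ _ mt.
have -> : last k (map (collapse k) t) = k.+1.
  by rewrite -[in X in last X _]ec last_map lastt /collapse (leqW (leqnn _)) subn1.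
rewrite map_rcons ec1 last_rcons -cats1 !score_cat.
rewrite count_cat size_cat !size_map /= ok.
have -> : step k k = 2 by rewrite /step eqxx /= ok ltnn.
by move: kn en szp cnt; clear; lia.
Qed.

End Permutation.

(** * Assembling the cases *)

Lemma embed_perm n (p : seq nat) : is_perm n p ->
  exists2 u, weak_iso u p & subseq u (zigzag n true n ++ nseq (~~ odd n) 1).
Proof.
move=> pp.
have wid : weak_iso p p by [].
have widen u : subseq u (zigzag n true n) ->
    subseq u (zigzag n true n ++ nseq (~~ odd n) 1).
  by move=> su; apply: subseq_trans su (prefix_subseq _ _).
have [/hasP[k]|/hasPn near] :=
  boolP (has (fun k => (index k.+1 p).+1 < index k p) (iota 1 n.-1)).
  rewrite mem_iota => kn /(embed_distant n p pp k)[|u iso /widen su]; first by lia.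
  by exists u.
have lp : path layered 0 p.
  apply: (path_layered n p pp) => // k kn; rewrite leqNgt; apply: near.
  by rewrite mem_iota; lia.
have [easy|] := boolP (odd n || ~~ odd (last 0 p)).
  by exists p => //; apply: widen; apply: embed_layered_easy.
rewrite negb_or negbK => /andP[en ol].
have [l1|nl1] := eqVneq (last 0 p) 1.
  by exists p => //; rewrite en; apply: embed_last1.
have [k lk] : exists k, last 0 p = k.+3 by exists ((last 0 p) - 3); lia.
have ok : odd k.+1 by move: ol; rewrite lk /= negbK.
(* If [k.+1] directly follows [k.+2], these two are tied; otherwise nothing obstructs pushing [k.+2]
   and [k.+3] up. *)
have [adj|nadj] := eqVneq (index k.+1 p) (index k.+2 p).+1.
  have [u iso /widen su] := embed_collapse n p pp lp k.+1 en ok lk adj.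
  by exists u.
have ek : ~~ odd k.+2 by rewrite /= in ok *; rewrite ok.
have [u iso /widen su] := embed_push n p pp lp k.+2 en ek isT lk nadj.
by exists u.
Qed.

Theorem theorem6p4 (n : nat) : 1 <= n ->
  exists w : seq nat,
    word_over_P w /\ size w = ceil_half_sq_plus1 n /\
    forall pi : seq nat, is_perm n pi -> contains_pattern w pi.
Proof.
move=> _; pose w := zigzag n true n ++ nseq (~~ odd n) 1.
exists (standardize (size w) w); split; [|split].
- apply: standardize_gt0; rewrite all_cat zigzag_gt0 /=.
  by case: (odd n).
(* The runs have [n^2/2] letters for even [n], and [((n+1)/2)^2 + ((n-1)/2)^2 = (n^2+1)/2] for odd
   [n]. *)
- rewrite size_standardize size_cat size_zigzag size_nseq /ceil_half_sq_plus1.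
  by have := odd_double_half n; rewrite uphalf_half -muln2; case: (odd n) => /=; nia.
- move=> pi pip; have [u iso su] := embed_perm _ _ pip.
  by apply: contains_standardize iso su; rewrite (perm_uniq pip) iota_uniq.
Qed.
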